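(* Let $T\ge 1$ be an integer and $\delta\in(0,1)$. Run the random reshuffling method (RR) for $T$ epochs from $x_0\in\mathbb{R}^d$ with constant step size $$\alpha_t=\alpha:=\min\left\{\frac{1}{4nL},\ \frac{1}{(C_1n^2T)^{1/3}}\right\},\qquad 0\le t\le T-1,\qquad C_1:=32L^2A\log^2\!\left(\frac{8nT}{\delta}\right).$$ Then, with probability at least $1-\delta$, $$\frac1T\sum_{t=0}^{T-1}\|\nabla f(x_t)\|^2\le\max\left\{\frac{45\,L\,F}{T},\ \frac{35\,L^{2/3}A^{1/3}F\,\log^{2/3}(8nT/\delta)}{n^{1/3}T^{2/3}}\right\}.$$ Consequently, to achieve $\frac1T\sum_{t=0}^{T-1}\|\nabla f(x_t)\|^2\le\varepsilon^2$ (with probability at least $1-\delta$), RR needs at most $$nT=\tilde{\mathcal O}\left(\max\{\sqrt n\,\varepsilon^{-3},\ n\varepsilon^{-2}\}\right)$$ stochastic gradient evaluations, where $\tilde{\mathcal O}$ hides an additional factor $\log(\sqrt n\,\varepsilon^{-3}/\delta)$.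
   Context: Problem: $f(x)=\frac1n\sum_{i=1}^n f_i(x)$ on $\mathbb{R}^d$. Each $f_i:\mathbb{R}^d\to\mathbb{R}$ is continuously differentiable (not necessarily convex), bounded from below by $\bar f_i\in\mathbb{R}$, and $\nabla f_i$ is Lipschitz continuous with parameter $L>0$. Let $\bar f$ be a lower bound of $f$ (e.g. its optimal value), and set $A=2L>0$ and $B=\frac{A}{n}\sum_{i=1}^n(\bar f-\bar f_i)$, with $\bar f$ such that $B\ge0$ (automatic if $\bar f=\inf f$). Set $F:=3(f(x_0)-\bar f)+3B/A\ge0$. $\|\cdot\|$ is the Euclidean norm. RR: let $\Pi$ be the set of all permutations of $\{1,\dots,n\}$. At epoch $t=0,1,\dots$, a permutation $\pi_t=(\pi_t^1,\dots,\pi_t^n)$ is sampled uniformly at random from $\Pi$, independently of the past (so independently of $x_t$); set $x_t^0=x_t$, $x_t^i=x_t^{i-1}-\alpha_t\nabla f_{\pi_t^i}(x_t^{i-1})$ for $i=1,\dots,n$, and $x_{t+1}=x_t^n$. The initial point $x_0$ is deterministic. Each epoch uses $n$ stochastic (component) gradient evaluations. Complexity notation: the last claim means that there is a constant $C$ depending only on $L$, $f(x_0)-\bar f$ and $B$ such that for all $\varepsilon\in(0,1]$ there is a choice of $T$ (with the corresponding step size above) with $nT\le C\max\{\sqrt n\,\varepsilon^{-3},n\varepsilon^{-2}\}\,(1+\log(\sqrt n\,\varepsilon^{-3}/\delta))$ for which the desired bound holds with probability at least $1-\delta$. *)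

(* Defs.v *)
From HB Require Import structures.
From mathcomp Require Import all_boot all_order all_algebra all_fingroup.
From mathcomp Require Import all_classical all_reals all_analysis.

Set Implicit Arguments.
Unset Strict Implicit.
Unset Printing Implicit Defensive.

Import Order.TTheory GRing.Theory Num.Theory.
Import numFieldNormedType.Exports.

Local Open Scope classical_set_scope.
Local Open Scope ring_scope.

Section Problem.
Context {R : realType} {d : nat}.
Implicit Types (x y : 'rV[R]_d) (g : 'rV[R]_d -> R).

(* The norm [`|x|] of the library on ['rV[R]_d] is the max norm, hence the
   separate Euclidean norm; both induce the same topology, so [differentiable]
   and [continuous] below have their usual meaning. *)
Definition enorm x : R := Num.sqrt (\sum_(i < d) x ord0 i ^+ 2).

Definition gradient g x : 'rV[R]_d := \row_(i < d) 'D_(delta_mx ord0 i) g x.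

Definition continuously_differentiable g : Prop :=
  (forall x, differentiable g x) /\ continuous (gradient g).

Definition gradient_lipschitz (L : R) g : Prop :=
  forall x y, enorm (gradient g x - gradient g y) <= L * enorm (x - y).

Definition lower_bound (c : R) g : Prop := forall x, c <= g x.

Context {n : nat}.
Implicit Types (f : 'I_n -> 'rV[R]_d -> R).

Definition objective f x : R := n%:R^-1 * \sum_(i < n) f i x.

Definition constA (L : R) : R := 2 * L.

Definition constB (L fbar : R) (fbars : 'I_n -> R) : R :=
  constA L / n%:R * \sum_(i < n) (fbar - fbars i).

Definition constF f (L fbar : R) (fbars : 'I_n -> R) x0 : R :=
  3 * (objective f x0 - fbar) + 3 * constB L fbar fbars / constA L.

Record finite_sum_problem f (L fbar : R) (fbars : 'I_n -> R) : Prop := {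
  n_gt0 : (0 < n)%N;
  L_gt0 : 0 < L;
  f_C1 : forall i, continuously_differentiable (f i);
  f_lipschitz : forall i, gradient_lipschitz L (f i);
  f_lower_bound : forall i, lower_bound (fbars i) (f i);
  objective_lower_bound : lower_bound fbar (objective f);
  B_ge0 : 0 <= constB L fbar fbars
}.

(* One epoch: the components are visited in the order [p 0, ..., p (n - 1)]
   ([enum 'I_n] is increasing). *)
Definition rr_epoch f (a : R) (p : 'S_n) x : 'rV[R]_d :=
  foldl (fun y i => y - a *: gradient (f (p i)) y) x (enum 'I_n).

Fixpoint rr f (alpha : nat -> R) (p : nat -> 'S_n) x0 (t : nat) : 'rV[R]_d :=
  if t is s.+1 then rr_epoch f (alpha s) (p s) (rr f alpha p x0 s) else x0.

Definition mean_sq_grad f (x : nat -> 'rV[R]_d) (T : nat) : R :=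
  T%:R^-1 * \sum_(t < T) enorm (gradient (objective f) (x t)) ^+ 2.

End Problem.

Section StepSize.
Context {R : realType}.
Implicit Types (L delta : R) (n T : nat).

Definition log_factor n T delta : R := ln (8 * n%:R * T%:R / delta).

Definition constC1 L n T delta : R :=
  32 * L ^+ 2 * constA L * log_factor n T delta ^+ 2.

Definition step_size L n T delta : R :=
  Num.min (4 * n%:R * L)^-1
          ((constC1 L n T delta * n%:R ^+ 2 * T%:R) `^ (1 / 3))^-1.

End StepSize.

(* [perms 0, ..., perms (T - 1)] are random permutations, each of them uniform and
   independent of the tuple of the previous ones; ['S_n] carries the discrete
   sigma-algebra, so measurability is that of the fibres. *)
Record rr_sampling {R : realType} {d : measure_display} {Omega : measurableType d}
    (P : probability Omega R) {n : nat} (T : nat)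
    (perms : nat -> Omega -> 'S_n) : Prop := {
  sampling_measurable : forall t (s : 'S_n), (t < T)%N ->
    measurable (perms t @^-1` [set s]);
  sampling_uniform : forall t (s : 'S_n), (t < T)%N ->
    P (perms t @^-1` [set s]) = ((n`!)%:R^-1)%:E;
  sampling_indep : forall t (S : {set 'S_n}) (H : {set {ffun 'I_t -> 'S_n}}),
    (t < T)%N ->
    P ([set w | perms t w \in S] `&` [set w | [ffun k : 'I_t => perms k w] \in H]) =
    (P [set w | perms t w \in S] *
     P [set w | [ffun k : 'I_t => perms k w] \in H])%E
}.

(* Main.v *)
Require Import Defs.
From HB Require Import structures.
From mathcomp Require Import all_boot all_order all_algebra all_fingroup.
From mathcomp Require Import all_classical all_reals all_analysis.
From mathcomp Require Import zify ring lra.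
Import Order.TTheory GRing.Theory Num.Theory.
Import numFieldNormedType.Exports.
Local Open Scope classical_set_scope.
Local Open Scope ring_scope.

Set Implicit Arguments.
Unset Strict Implicit.
Unset Printing Implicit Defensive.

(* Write z_t = f(x_t) - fbar + B/A.  The centred component gradients at x_t sum to zero
   and, by L-smoothness and lower boundedness, have total squared norm at most n A z_t.
   Their partial sums S_k along a uniform permutation concentrate without any dependence
   on the dimension: averaging exp(sqrt(1 + |S_k|^2)) over the k-th draw, the first-order
   term is a negative multiple of |S_k|^2, because the vectors not yet drawn sum to
   -S_k, and the second-order terms sum to a constant as long as k <= n/2; for k > n/2
   reverse the permutation.  Hence outside an event of probability delta/T all |S_k| of
   an epoch are at most 3 sqrt(n A z_t) log(8nT/delta), so the iterates of the epoch stay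
   close to x_t and the descent lemma gives
     z_(t+1) + (7/18) n alpha |grad f(x_t)|^2 <= (1 + 1/(2T)) z_t.
   Telescoping bounds the mean squared gradient by (12/7) F / (n alpha T), which is
   smaller than the claimed bound. *)

(** * Euclidean norm and smooth functions *)

Section Euclidean.
Context {R : realType} {d : nat}.
Implicit Types (x y z : 'rV[R]_d).

Definition dotv x y : R := \sum_(i < d) x ord0 i * y ord0 i.

Lemma dotvC x y : dotv x y = dotv y x.
Proof. by apply: eq_bigr => i _; rewrite mulrC. Qed.

Lemma dotvDl x y z : dotv (x + y) z = dotv x z + dotv y z.
Proof. by rewrite -big_split; apply: eq_bigr => i _; rewrite mxE mulrDl. Qed.

Lemma dotvZl a x y : dotv (a *: x) y = a * dotv x y.
Proof. by rewrite mulr_sumr; apply: eq_bigr => i _; rewrite mxE mulrA. Qed.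

Lemma dotvNl x y : dotv (- x) y = - dotv x y.
Proof. by rewrite -scaleN1r dotvZl mulN1r. Qed.

Lemma dotvDr x y z : dotv x (y + z) = dotv x y + dotv x z.
Proof. by rewrite dotvC dotvDl !(dotvC _ x). Qed.

Lemma dotvZr a x y : dotv x (a *: y) = a * dotv x y.
Proof. by rewrite dotvC dotvZl dotvC. Qed.

Lemma dotvNr x y : dotv x (- y) = - dotv x y.
Proof. by rewrite dotvC dotvNl dotvC. Qed.

Lemma dotv0r x : dotv x 0 = 0.
Proof. by rewrite -(scale0r 0) dotvZr mul0r. Qed.

Lemma dotv_sumr I (r : seq I) (P : pred I) x (F : I -> 'rV[R]_d) :
  dotv x (\sum_(i <- r | P i) F i) = \sum_(i <- r | P i) dotv x (F i).
Proof.
by elim/big_rec2: _ => [|i y1 y2 _ <-]; rewrite ?dotv0r ?dotvDr.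
Qed.

Lemma dotvv_ge0 x : 0 <= dotv x x.
Proof. by apply: sumr_ge0 => i _; rewrite -expr2 sqr_ge0. Qed.

Lemma dotvv_eq0 x : dotv x x = 0 -> x = 0.
Proof.
move=> /eqP; rewrite psumr_eq0; last by move=> i _; rewrite -expr2 sqr_ge0.
move=> /allP x0; apply/rowP => i; rewrite mxE.
by have := x0 i (mem_index_enum i); rewrite -expr2 sqrf_eq0 => /eqP.
Qed.

Lemma enorm_ge0 x : 0 <= enorm x.
Proof. exact: sqrtr_ge0. Qed.

Lemma enorm_sqr x : enorm x ^+ 2 = dotv x x.
Proof.
rewrite /enorm sqr_sqrtr; last by apply: sumr_ge0 => i _; exact: sqr_ge0.
by apply: eq_bigr => i _; rewrite expr2.
Qed.

Lemma enorm0 : enorm (0 : 'rV[R]_d) = 0.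
Proof.
by apply/eqP; rewrite -sqrf_eq0 enorm_sqr dotv0r.
Qed.

Lemma enorm_eq0 x : enorm x = 0 -> x = 0.
Proof. by move=> x0; apply: dotvv_eq0; rewrite -enorm_sqr x0 expr0n. Qed.

Lemma enormZ a x : enorm (a *: x) = `|a| * enorm x.
Proof.
apply/eqP; rewrite -(eqrXn2 (n := 2)) ?mulr_ge0 ?enorm_ge0//.
by rewrite exprMn real_normK ?num_real// !enorm_sqr dotvZl dotvZr; apply/eqP; ring.
Qed.

Lemma enormN x : enorm (- x) = enorm x.
Proof. by rewrite -scaleN1r enormZ normrN1 mul1r. Qed.

Lemma cauchy_schwarz x y : `|dotv x y| <= enorm x * enorm y.
Proof.
rewrite -(ler_pXn2r (n := 2)) ?nnegrE ?mulr_ge0 ?enorm_ge0//.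
rewrite real_normK ?num_real// exprMn !enorm_sqr.
have [/dotvv_eq0 ->|y0] := eqVneq (dotv y y) 0.
  by rewrite !dotv0r expr0n mulr0.
have ygt0 : 0 < dotv y y by rewrite lt0r y0 dotvv_ge0.
have := dotvv_ge0 (dotv y y *: x - dotv x y *: y).
rewrite !(dotvDl, dotvDr, dotvNl, dotvNr, dotvZl, dotvZr) (dotvC y x).
rewrite -(pmulr_rge0 _ ygt0) => H.
have : 0 <= dotv y y * (dotv x x * dotv y y - dotv x y ^+ 2).
  rewrite -(pmulr_rge0 _ ygt0); apply: le_trans H _.
  by rewrite le_eqVlt; apply/orP; left; apply/eqP; ring.
by rewrite pmulr_rge0// subr_ge0.
Qed.

Lemma dotv_le x y : dotv x y <= enorm x * enorm y.
Proof. exact: le_trans (ler_norm _) (cauchy_schwarz _ _). Qed.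

Lemma enormD x y : enorm (x + y) <= enorm x + enorm y.
Proof.
rewrite -(ler_pXn2r (n := 2)) ?nnegrE ?addr_ge0 ?enorm_ge0//.
rewrite enorm_sqr sqrrD !enorm_sqr !(dotvDl, dotvDr) (dotvC y x).
have := dotv_le x y; lra.
Qed.

Lemma enorm_sum I (r : seq I) (P : pred I) (F : I -> 'rV[R]_d) :
  enorm (\sum_(i <- r | P i) F i) <= \sum_(i <- r | P i) enorm (F i).
Proof.
elim/big_rec2: _ => [|i y1 y2 _ IH]; first by rewrite enorm0.
by apply: le_trans (enormD _ _) _; rewrite lerD2l.
Qed.

End Euclidean.

(** * Derivatives along lines and the descent inequality *)

Section Smooth.
Context {R : realType} {d : nat}.
Implicit Types (x y v : 'rV[R]_d) (g : 'rV[R]_d -> R).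

Lemma derive_dotv g x v : differentiable g x -> 'D_v g x = dotv (gradient g x) v.
Proof.
move=> dg; rewrite {1}(row_sum_delta v) deriveE// linear_sum.
apply: eq_bigr => i _; rewrite linearZ /= mxE deriveE//.
by rewrite mulrC.
Qed.

Lemma is_derive_line g x v (t : R) : differentiable g (x + t *: v) ->
  is_derive t 1 (fun s : R => g (x + s *: v))
    (dotv (gradient g (x + t *: v)) v).
Proof.
move=> dg; rewrite -derive_dotv//.
(* The difference quotient of the restriction to the line at [t] is that of [g] at [x + t *: v] in
   direction [v], so the one derivative is read off from the other. *)
have quotE : (fun h : R => h^-1 *: (g (x + (h *: 1 + t) *: v) - g (x + t *: v)))
    = (fun h : R => h^-1 *: (g (h *: v + (x + t *: v)) - g (x + t *: v))).
  apply/funext => h; congr (_ *: (g _ - _)).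
  by rewrite scalerDl addrCA [h *: 1]mulr1.
apply: DeriveDef; last by rewrite /derive /= quotE.
by have := @diff_derivable _ _ _ g _ v dg; rewrite /derivable /= quotE.
Qed.

(** Restrict [g] to the segment from [x] to [y] and subtract the linear and quadratic terms. By
    Cauchy-Schwarz and the Lipschitz bound the difference [h] has nonpositive derivative, so
    [h 1 <= h 0]. *)
Lemma descent (L : R) g x y : (forall z, differentiable g z) ->
  gradient_lipschitz L g ->
  g y <= g x + dotv (gradient g x) (y - x) + L / 2 * enorm (y - x) ^+ 2.
Proof.
move=> dg lipg; set v := y - x; set e := enorm v ^+ 2.
pose phi := fun t : R => g (x + t *: v).
pose h := fun t : R => phi t - dotv (gradient g x) v * t - L / 2 * e * t ^+ 2.
have dh (t : R) : is_derive t 1 h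
    (dotv (gradient g (x + t *: v) - gradient g x) v - L * e * t).
  have dphi := is_derive_line (dg (x + t *: v)).
  rewrite (_ : h = phi - (dotv (gradient g x) v) *: (id : R -> R)
      - (L / 2 * e) *: ((id : R -> R) ^+ 2)); last first.
    by apply/funext => s; rewrite /h !fctE.
  apply: is_derive_eq; rewrite dotvDl dotvNl /= !scaler1.
  by rewrite /GRing.scale /=; field.
have : h 1 <= h 0.
  apply: (@ler0_derive1_le_cc _ h 0 1); rewrite ?in_itv/= ?lexx ?ler01//.
  - move=> t; rewrite in_itv/= => /andP[t0 _]; rewrite derive1E (@derive_val _ _ _ _ _ _ _ (dh t)).
    rewrite subr_le0; apply: le_trans (dotv_le _ _) _.
    have := lipg (x + t *: v) x; rewrite addrAC subrr add0r enormZ gtr0_norm// => lt.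
    apply: le_trans (ler_wpM2r (enorm_ge0 _) lt) _.
    by rewrite /e le_eqVlt; apply/orP; left; apply/eqP; ring.
  - apply: derivable_within_continuous => t _; exact: ex_derive.
have xvE : x + v = y by rewrite /v addrC subrK.
rewrite /h /phi scale1r scale0r addr0 xvE.
rewrite expr0n expr1n /=; lra.
Qed.

(** A gradient step of length 1/L decreases [g] by at least |G|^2 / (2L), and the value reached is
    still at least [c]. *)
Lemma grad_self_bound (L c : R) g x : 0 < L -> (forall z, differentiable g z) ->
  gradient_lipschitz L g -> lower_bound c g ->
  enorm (gradient g x) ^+ 2 <= 2 * L * (g x - c).
Proof.
move=> L0 dg lipg cg; set G := gradient g x.
have := descent x (x - L^-1 *: G) dg lipg.
rewrite [x - _ - x]addrAC subrr add0r dotvNr dotvZr -enorm_sqr -/G enormN enormZ exprMn.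
rewrite real_normK ?num_real// => H.
have {H} : c <= g x - (2 * L)^-1 * enorm G ^+ 2.
  apply: le_trans (cg _) (le_trans H _).
  by rewrite le_eqVlt; apply/orP; left; apply/eqP; field; rewrite gt_eqF.
rewrite lerBrDr -lerBrDl ler_pdivrMl ?mulr_gt0//.
Qed.

Lemma gradient_lin n (f : 'I_n -> 'rV[R]_d -> R) (a : R) x :
  (forall i, differentiable (f i) x) ->
  gradient (fun z => a * \sum_(i < n) f i z) x = a *: \sum_(i < n) gradient (f i) x.
Proof.
move=> df; apply/rowP => j; rewrite !mxE summxE.
rewrite (_ : (fun z => _) = a *: \sum_(i < n) f i); last first.
  by apply/funext => z; rewrite !fctE fct_sumE.
rewrite deriveZ; last by apply: derivable_sum => i; exact: diff_derivable.
rewrite derive_sum; last by move=> i; exact: diff_derivable.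
by congr (_ * _); apply: eq_bigr => i _; rewrite mxE.
Qed.

End Smooth.

(** * Concentration for sampling without replacement *)

(** From exp(-y) >= 1 - y one gets exp(y) <= 1/(1 - y), and (1 + y + 2y^2)(1 - y) - 1 = y^2 (1 - 2y)
    >= 0. *)
Lemma expR_le_quad {R : realType} (y : R) : y <= 1 / 2 -> expR y <= 1 + y + 2 * y ^+ 2.
Proof.
move=> y2; rewrite -[y in expR y]opprK expRN.
have := expR_ge1Dx (- y) => ey.
apply: (@le_trans _ _ (1 - y)^-1); first by rewrite lef_pV2 ?posrE ?expR_gt0//; lra.
rewrite -[_^-1]mul1r ler_pdivrMr; last by lra.
have : 0 <= y ^+ 2 * (1 - 2 * y) by rewrite mulr_ge0 ?sqr_ge0//; lra.
by rewrite -subr_ge0 => H; rewrite -subr_ge0; apply: le_trans H _;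
  rewrite le_eqVlt; apply/orP; left; apply/eqP; ring.
Qed.

(** * A smoothed Euclidean norm and its exponential *)

Section SmoothedNorm.
Context {R : realType} {d : nat}.
Implicit Types (s x : 'rV[R]_d).

Definition snorm s : R := Num.sqrt (1 + enorm s ^+ 2).

Lemma snorm_sqr s : snorm s ^+ 2 = 1 + enorm s ^+ 2.
Proof. by rewrite sqr_sqrtr// addr_ge0 ?sqr_ge0. Qed.

Lemma snorm_ge1 s : 1 <= snorm s.
Proof.
by rewrite -{1}sqrtr1 ler_wsqrtr// lerDl sqr_ge0.
Qed.

Lemma enorm_le_snorm s : enorm s <= snorm s.
Proof.
rewrite -(ler_pXn2r (n := 2)) ?nnegrE ?enorm_ge0 ?sqrtr_ge0// snorm_sqr.
by rewrite lerDr.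
Qed.

(** Tangent-line bound for the concave square root at 1 + |s|^2, whose argument grows by 2 <s, x> +
    |x|^2. *)
Lemma snormD_le s x :
  snorm (s + x) <= snorm s + (dotv s x / snorm s + enorm x ^+ 2 / (2 * snorm s)).
Proof.
have s1 := snorm_ge1 s.
have s0 : 0 < snorm s by apply: lt_le_trans s1.
set e := dotv s x / snorm s + _.
have eE : 2 * snorm s * e = enorm (s + x) ^+ 2 - enorm s ^+ 2.
  rewrite /e !enorm_sqr !(dotvDl, dotvDr) (dotvC x s); field.
  by rewrite gt_eqF.
(* Both sides are squared below, which requires the right-hand side to be nonnegative. *)
have se0 : 0 <= snorm s + e.
  rewrite -(pmulr_rge0 _ s0).
  have -> : snorm s * (snorm s + e) = snorm s ^+ 2 + 2 * snorm s * e / 2 by field.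
  rewrite eE snorm_sqr; have := sqr_ge0 (enorm (s + x)); have := sqr_ge0 (enorm s); lra.
rewrite -(ler_pXn2r (n := 2)) ?nnegrE ?sqrtr_ge0// sqrrD !snorm_sqr.
have := sqr_ge0 e; have -> : snorm s * e *+ 2 = 2 * snorm s * e by rewrite -mulr_natl; ring.
rewrite eE; lra.
Qed.

(** The exponent grows by at most u + w with |u| <= |x| and w <= |x|^2 / 2 <= |x| / 6, hence |u + w|
    <= 7/6 |x| <= 1/2 and [expR_le_quad] applies. The second-order total 1/2 + 2 (7/6)^2 is below
    9/2. *)
Lemma expR_snormD s x : enorm x <= 1 / 3 ->
  expR (snorm (s + x)) <=
  expR (snorm s) * (1 + dotv s x / snorm s + 9 / 2 * enorm x ^+ 2).
Proof.
move=> x3; have s1 := snorm_ge1 s; have x0 := enorm_ge0 x.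
have s0 : 0 < snorm s by apply: lt_le_trans s1.
have := snormD_le s x; rewrite -ler_expR => /le_trans; apply.
rewrite expRD ler_pM2l ?expR_gt0//.
set u := dotv s x / snorm s; set w := enorm x ^+ 2 / _.
have ux : `|u| <= enorm x.
  rewrite normrM normfV (gtr0_norm s0) ler_pdivrMr// mulrC.
  apply: le_trans (cauchy_schwarz _ _) _.
  by rewrite ler_wpM2r// enorm_le_snorm.
have wx : w <= enorm x ^+ 2 / 2.
  rewrite /w ler_wpM2l ?sqr_ge0// lef_pV2 ?posrE ?mulr_gt0//; lra.
have w0 : 0 <= w by rewrite divr_ge0 ?sqr_ge0 ?mulr_ge0 ?ltW.
have xx : enorm x ^+ 2 <= enorm x / 3 by rewrite expr2; nra.
move: ux; rewrite ler_norml => /andP[u1 u2].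
apply: le_trans (expR_le_quad _) _; first by lra.
have : (u + w) ^+ 2 <= (7 / 6 * enorm x) ^+ 2.
  by rewrite -[leRHS]real_normK ?num_real// -[leLHS]real_normK ?num_real//
    lerXn2r ?nnegrE// ler_norml (@ger0_norm _ (7 / 6 * _)); lra.
by rewrite exprMn; have := sqr_ge0 (enorm x); lra.
Qed.

End SmoothedNorm.

(** * Partial sums along a random permutation *)

Section Reshuffling.
Context {R : realType} {d n : nat}.
Implicit Types (X : 'I_n -> 'rV[R]_d) (p : 'S_n) (k : nat).

Definition psum X p k : 'rV[R]_d := \sum_(i < n | (i < k)%N) X (p i).

Lemma psumS X p (k : 'I_n) : psum X p k.+1 = psum X p k + X (p k).
Proof.
rewrite /psum (bigD1 k) //= addrC; congr (_ + _).
by apply: eq_bigl => i; rewrite ltnS ltn_neqAle andbC.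
Qed.

Lemma sum_perm (V : nmodType) (F : 'I_n -> V) p : \sum_i F (p i) = \sum_i F i.
Proof. by rewrite [RHS](reindex_inj (@perm_inj _ p)). Qed.

Lemma psum_tail X p k : \sum_i X i = 0 ->
  \sum_(i < n | (k <= i)%N) X (p i) = - psum X p k.
Proof.
rewrite -(sum_perm _ p) (bigID (fun i : 'I_n => (i < k)%N)) /= => /eqP.
rewrite addrC addr_eq0 => /eqP <-; by apply: eq_bigl => i; rewrite leqNgt.
Qed.

Definition revp : 'S_n := perm (@rev_ord_inj n).

(** The first [k] draws of the reversed order are the last [k] draws of [p], and the total is
    zero. *)
Lemma psum_rev X p k : (k <= n)%N -> \sum_i X i = 0 ->
  psum X (revp * p)%g k = - psum X p (n - k).
Proof.
move=> kn X0; rewrite -psum_tail// /psum (reindex_inj (@rev_ord_inj n)) /=.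
apply: eq_big => [i|i _]; last by rewrite permM permE rev_ordK.
by have := ltn_ord i; move=> /= ?; apply/idP/idP; lia.
Qed.

(** The left factor of a product of permutations acts first, so [tperm k j] exchanges two positions,
    both outside the first [k] draws. *)
Lemma psum_tperm X p (k j : 'I_n) : (k <= j)%N ->
  psum X (tperm k j * p)%g k.+1 = psum X p k + X (p j).
Proof.
move=> kj; rewrite psumS permM tpermL; congr (_ + _).
by apply: eq_bigr => i ik; rewrite permM tpermD// -val_eqE /= gtn_eqF// (leq_trans ik).
Qed.

(** This is n factorial times an expectation under the uniform law; keeping the sum lets the
    concentration argument run by counting alone. *)
Definition mgf X k : R := \sum_(p : 'S_n) expR (snorm (psum X p k)).

(* Exchanging the [k]-th draw with a uniformly chosen later one preserves the
   uniform law; the remaining vectors sum to [- psum X p k], so the first-order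
   term of [expR_snormD] averages to a nonpositive number and is dropped. *)
Lemma mgfS X (k : 'I_n) : \sum_i X i = 0 -> \sum_i enorm (X i) ^+ 2 <= 1 / 9 ->
  mgf X k.+1 <= (1 + (2 * (n - k)%:R)^-1) * mgf X k.
Proof.
move=> X0 X9.
have X3 i : enorm (X i) <= 1 / 3.
  rewrite -(ler_pXn2r (n := 2)) ?nnegrE ?enorm_ge0 ?divr_ge0//.
  have -> : (1 / 3) ^+ 2 = 1 / 9 :> R by field.
  apply: le_trans X9; rewrite (bigD1 i)//= lerDl.
  by apply: sumr_ge0 => j _; exact: sqr_ge0.
have cardE : \sum_(j < n | (k <= j)%N) 1 = (n - k)%:R :> R.
  by rewrite -(big_geq_mkord k n xpredT (fun=> 1 : R)) sumr_const_nat.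
have nk0 : 0 < (n - k)%:R :> R by rewrite ltr0n subn_gt0.
rewrite -(ler_pM2l nk0).
have -> : (n - k)%:R * mgf X k.+1 =
    \sum_p \sum_(j < n | (k <= j)%N) expR (snorm (psum X p k + X (p j))).
  rewrite exchange_big -cardE mulr_suml; apply: eq_bigr => j kj.
  rewrite mul1r /mgf (reindex_inj (mulgI (tperm k j))).
  by apply: eq_bigr => p _; rewrite psum_tperm.
have -> : (n - k)%:R * ((1 + (2 * (n - k)%:R)^-1) * mgf X k) =
    \sum_p expR (snorm (psum X p k)) * ((n - k)%:R + 1 / 2).
  by rewrite -mulr_suml -/(mgf X k); field; rewrite gt_eqF.
apply: ler_sum => p _.
set s := psum X p k.
apply: (@le_trans _ _ (\sum_(j < n | (k <= j)%N) expR (snorm s) *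
  (1 + dotv s (X (p j)) / snorm s + 9 / 2 * enorm (X (p j)) ^+ 2))).
  by apply: ler_sum => j _; exact: expR_snormD.
rewrite -mulr_sumr ler_pM2l ?expR_gt0// !big_split /= cardE -addrA lerD2l.
rewrite -mulr_suml -dotv_sumr psum_tail// -/s dotvNr -mulr_sumr.
(* With the coefficient 9/2 the second-order terms contribute at most 1/2, which is the gain allowed
   by the factor 1 + 1/(2(n - k)). *)
have : \sum_(j < n | (k <= j)%N) enorm (X (p j)) ^+ 2 <= 1 / 9.
  apply: le_trans X9; rewrite -(sum_perm _ p).
  rewrite [leRHS](bigID (fun j : 'I_n => (k <= j)%N)) /= lerDl.
  by apply: sumr_ge0 => j _; exact: sqr_ge0.
have : 0 <= dotv s s / snorm s by rewrite divr_ge0 ?dotvv_ge0 ?sqrtr_ge0.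
rewrite mulNr; lra.
Qed.

Lemma mgf0 X : mgf X 0 = n`!%:R * expR 1.
Proof.
rewrite /mgf (eq_bigr (fun=> expR 1)); last first.
  move=> p _; rewrite /psum big_pred0 ?/snorm ?enorm0 ?expr0n ?addr0 ?sqrtr1//.
by rewrite sumr_const card_Sn mulr_natl.
Qed.

(** In the first half 2(n - k) >= n, so each factor of [mgfS] is at most 1 + 1/n <= exp(1/n). *)
Lemma mgf_half X k : (k.*2 <= n)%N -> \sum_i X i = 0 ->
  \sum_i enorm (X i) ^+ 2 <= 1 / 9 ->
  mgf X k <= n`!%:R * expR (1 + k%:R / n%:R).
Proof.
move=> kn X0 X9; elim: k kn => [|k IH] kn; first by rewrite mgf0 mul0r addr0.
have kn' : (k < n)%N by lia.
have n0 : 0 < n%:R :> R by rewrite ltr0n; lia.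
apply: le_trans (mgfS (Ordinal kn') X0 X9) _ => /=.
have /IH {}IH : (k.*2 <= n)%N by lia.
have -> : 1 + k.+1%:R / n%:R = n%:R^-1 + (1 + k%:R / n%:R) :> R.
  by rewrite -natr1; field; rewrite gt_eqF.
rewrite expRD mulrCA; apply: ler_pM => //.
- by apply: sumr_ge0 => p _; exact: expR_ge0.
- apply: le_trans (expR_ge1Dx _); rewrite lerD2l lef_pV2 ?posrE//.
    by rewrite -natrM ler_nat; lia.
  by rewrite mulr_gt0// ltr0n; lia.
Qed.

Lemma expR_32 : expR (3 / 2) <= 8 :> R.
Proof.
(* [expR_le_quad] is usable only up to 1/2; at 1/4 it gives 11/8, and (11/8)^6 < 8. *)
have -> : 3 / 2 = 6%:R * (1 / 4) :> R by field.
rewrite expRM_natl.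
have e14 : expR (1 / 4) <= 11 / 8 :> R.
  by apply: le_trans (expR_le_quad _) _; lra.
apply: le_trans (lerXn2r 6 _ _ e14) _; rewrite ?nnegrE ?expR_ge0//; lra.
Qed.

Lemma mgf_le X k : (k <= n)%N -> \sum_i X i = 0 ->
  \sum_i enorm (X i) ^+ 2 <= 1 / 9 -> mgf X k <= 8 * n`!%:R.
Proof.
move=> kn X0 X9.
have half j : (j.*2 <= n)%N -> mgf X j <= 8 * n`!%:R.
  move=> jn; apply: le_trans (mgf_half jn X0 X9) _.
  rewrite mulrC ler_wpM2r//; apply: le_trans expR_32; rewrite ler_expR.
  have : j%:R / n%:R <= 1 / 2 :> R.
    have [->|n0] := posnP n; first by rewrite invr0 mulr0; lra.
    rewrite ler_pdivrMr ?ltr0n// mulrAC ler_pdivlMr// mul1r -natrM ler_nat; lia.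
  lra.
case: (leqP k.*2 n) => [/half//|kn2].
(* Past the middle, reversing every permutation replaces [k] by [n - k] up to a sign inside the
   norm. *)
have -> : mgf X k = mgf X (n - k); last by apply: half; lia.
rewrite /mgf (reindex_inj (mulgI revp)); apply: eq_bigr => p _.
by rewrite psum_rev// /snorm enormN.
Qed.

(** Markov's inequality in counting form: after rescaling by [m] the squared norms sum to 1/9,
    [mgf_le] applies, and each permutation in [S] contributes at least exp(l). *)
Lemma card_psum_gt X k (l : R) : (k <= n)%N -> \sum_i X i = 0 ->
  #|[set p : 'S_n | 3 * Num.sqrt (\sum_i enorm (X i) ^+ 2) * l < enorm (psum X p k)]%SET|%:R
  <= 8 * expR (- l) * n`!%:R.
Proof.
move=> kn X0; set v := \sum_i _; set S := finset _.
have v0 : 0 <= v by apply: sumr_ge0 => i _; exact: sqr_ge0.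
(* When [v] vanishes the rescaling is undefined, but then all vectors are zero and the strict
   inequality holds for no permutation. *)
have [v00|vn0] := eqVneq v 0.
  have Xz i : X i = 0.
    apply/enorm_eq0/eqP; rewrite -sqrf_eq0; apply/eqP.
    by apply: (psumr_eq0P _ v00) => // j _; exact: sqr_ge0.
  rewrite (_ : S = finset.set0) ?cards0 ?mulr_ge0 ?expR_ge0//.
  apply/setP => p; rewrite !inE v00 sqrtr0 mulr0 mul0r /psum big1 ?enorm0 ?ltxx//.
have sv : 0 < Num.sqrt v by rewrite sqrtr_gt0 lt0r vn0.
pose m := (3 * Num.sqrt v)^-1.
have m0 : 0 < m by rewrite invr_gt0 mulr_gt0.
pose Y i := m *: X i.
have YE p : psum Y p k = m *: psum X p k by rewrite scaler_sumr.
have : mgf Y k <= 8 * n`!%:R.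
  apply: mgf_le => //; first by rewrite -scaler_sumr X0 scaler0.
  rewrite (eq_bigr (fun i => m ^+ 2 * enorm (X i) ^+ 2)); last first.
    by move=> i _; rewrite enormZ exprMn real_normK ?num_real.
  rewrite -mulr_sumr -/v /m exprVn exprMn sqr_sqrtr//.
  by rewrite le_eqVlt; apply/orP; left; apply/eqP; field.
have -> : 8 * expR (- l) * n`!%:R = 8 * n`!%:R / expR l by rewrite expRN; ring.
rewrite ler_pdivlMr ?expR_gt0//; apply: le_trans.
rewrite /mgf (bigID (mem S)) /= -sum1_card natr_sum mulr_suml.
rewrite -[leLHS]addr0; apply: lerD; last by apply: sumr_ge0 => p _; exact: expR_ge0.
apply: ler_sum => p; rewrite inE => pS; rewrite mul1r ler_expR.
apply: le_trans (enorm_le_snorm _); rewrite YE enormZ gtr0_norm// /m.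
by rewrite mulrC ler_pdivlMr ?mulr_gt0// mulrC ltW.
Qed.

End Reshuffling.

(** * One epoch *)

Lemma sumr_const_ord {R : pzSemiRingType} n (c : R) : \sum_(i < n) c = n%:R * c.
Proof. by rewrite sumr_const card_ord mulr_natl. Qed.

Section Epoch.
Context {R : realType} {d n : nat}.
Variables (f : 'I_n -> 'rV[R]_d -> R) (L fbar : R) (fbars : 'I_n -> R).
Hypothesis pb : finite_sum_problem f L fbar fbars.
Implicit Types (x : 'rV[R]_d) (p : 'S_n) (k : nat) (a b l : R).

Let n0 : 0 < n%:R :> R. Proof. by rewrite ltr0n (n_gt0 pb). Qed.

Let L0 : 0 < L. Proof. exact: L_gt0 pb. Qed.

Let df i x : differentiable (f i) x. Proof. by have [] := f_C1 pb i. Qed.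

Lemma gradient_objective x :
  gradient (objective f) x = n%:R^-1 *: \sum_i gradient (f i) x.
Proof. exact: gradient_lin. Qed.

Lemma differentiable_objective x : differentiable (objective f) x.
Proof.
rewrite (_ : objective f = n%:R^-1 *: \sum_(i < n) f i); last first.
  by apply/funext => z; rewrite !fctE fct_sumE.
by apply: differentiableZ; apply: differentiable_sum.
Qed.

Lemma objective_gradient_lipschitz : gradient_lipschitz L (objective f).
Proof.
move=> x y; rewrite !gradient_objective -scalerBr enormZ gtr0_norm ?invr_gt0//.
rewrite ler_pdivrMl// -sumrB; apply: le_trans (enorm_sum _ _ _) _.
apply: le_trans (ler_sum _ (fun i _ => f_lipschitz pb i x y)) _.
by rewrite sumr_const_ord.
Qed.

Definition centered x (i : 'I_n) := gradient (f i) x - gradient (objective f) x.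

(** Since B/A is the mean of [fbar - fbars i], this equals the mean of [f i x - fbars i]. *)
Definition potential x : R := objective f x - fbar + constB L fbar fbars / constA L.

Lemma potential_ge0 x : 0 <= potential x.
Proof.
rewrite addr_ge0 ?subr_ge0 ?(objective_lower_bound pb)//.
by rewrite divr_ge0 ?(B_ge0 pb)// mulr_ge0// ltW.
Qed.

Lemma scale_gradient_objective x :
  n%:R *: gradient (objective f) x = \sum_i gradient (f i) x.
Proof. by rewrite gradient_objective scalerA divff ?scale1r ?gt_eqF. Qed.

Lemma sum_centered x : \sum_i centered x i = 0.
Proof.
rewrite sumrB -scale_gradient_objective sumr_const card_ord.
by rewrite scaler_nat subrr.
Qed.

(** Centering only lowers the total squared norm, by n |grad f(x)|^2; [grad_self_bound] for each
    component then sums to the potential. *)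
Lemma sum_centered_sqr x :
  \sum_i enorm (centered x i) ^+ 2 <= n%:R * constA L * potential x.
Proof.
set g := gradient (objective f) x.
have -> : \sum_i enorm (centered x i) ^+ 2 =
    \sum_i enorm (gradient (f i) x) ^+ 2 - n%:R * enorm g ^+ 2.
  have -> : n%:R * enorm g ^+ 2 = 2 * dotv g (\sum_i gradient (f i) x) - n%:R * enorm g ^+ 2.
    by rewrite -scale_gradient_objective -/g dotvZr enorm_sqr; ring.
  rewrite dotv_sumr mulr_sumr -(sumr_const_ord n (enorm g ^+ 2)) -!sumrB.
  apply: eq_bigr => i _; rewrite /centered -/g !enorm_sqr.
  by rewrite !(dotvDl, dotvDr, dotvNl, dotvNr) (dotvC _ g); ring.
have : \sum_i enorm (gradient (f i) x) ^+ 2 <= \sum_i constA L * (f i x - fbars i).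
  apply: ler_sum => i _; apply: grad_self_bound => //; first exact: f_lipschitz pb i.
  exact: f_lower_bound pb i.
have -> : \sum_i constA L * (f i x - fbars i) = n%:R * constA L * potential x.
  rewrite -mulr_sumr sumrB /potential /constB sumrB sumr_const card_ord.
  rewrite /objective -[fbar *+ n]mulr_natl /constA; field.
  by rewrite !gt_eqF.
have : 0 <= n%:R * enorm g ^+ 2 by rewrite mulr_ge0 ?sqr_ge0 ?ltW.
lra.
Qed.

Definition inner a p x k : 'rV[R]_d :=
  foldl (fun y i => y - a *: gradient (f (p i)) y) x (take k (enum 'I_n)).

Lemma inner_last a p x : inner a p x n = rr_epoch f a p x.
Proof. by rewrite /inner take_oversize// size_enum_ord. Qed.

Lemma innerE a p x k : (k <= n)%N ->
  inner a p x k = x - a *: \sum_(i < n | (i < k)%N) gradient (f (p i)) (inner a p x i).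
Proof.
elim: k => [|k IH] kn.
  by rewrite /inner take0 /= big_pred0// scaler0 subr0.
pose ko := Ordinal kn.
have -> : inner a p x k.+1 = inner a p x k - a *: gradient (f (p ko)) (inner a p x k).
  rewrite /inner (take_nth ko) ?size_enum_ord// -cats1 foldl_cat /=.
  by rewrite (nth_ord_enum ko ko).
rewrite {1}IH; last exact: ltnW.
rewrite [in RHS](bigD1 ko)//= scalerDr opprD addrA addrAC; congr (_ - _ - _).
by congr (_ *: _); apply: eq_bigl => i; rewrite ltnS ltn_neqAle andbC.
Qed.

(** Strong induction on [k]. Replacing the gradients at the inner iterates by those at [x] costs at
    most a n L D <= D/4, and the remaining terms, k grad f(x) plus the centered partial sum, give at
    most 3D/4. *)
Lemma inner_dev a b p x : 0 < a -> 4 * n%:R * L * a <= 1 ->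
  (forall k : 'I_n, enorm (psum (centered x) p k) <= b) ->
  forall k : 'I_n, enorm (inner a p x k - x) <=
    4 / 3 * a * (n%:R * enorm (gradient (objective f) x) + b).
Proof.
move=> a0 aL sb; set G := gradient (objective f) x; set D := 4 / 3 * _ * _.
have b0 : 0 <= b by apply: le_trans (sb (Ordinal (n_gt0 pb))); exact: enorm_ge0.
have D0 : 0 <= D.
  have G0 : 0 <= enorm G := enorm_ge0 G.
  by rewrite !mulr_ge0 ?addr_ge0 ?mulr_ge0// ltW.
have cardk k : (k <= n)%N -> forall c : R, \sum_(i < n | (i < k)%N) c = k%:R * c.
  by move=> kn c; rewrite -(big_ord_widen _ (fun=> c))// sumr_const_ord.
move=> [k kn] /=; elim/ltn_ind: k kn => k IH kn.
rewrite innerE; last exact: ltnW.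
rewrite [x - _ - x]addrAC subrr add0r enormN enormZ gtr0_norm//.
have kln : k%:R <= n%:R :> R by rewrite ler_nat ltnW.
have k0 : 0 <= k%:R :> R by [].
have -> : \sum_(i < n | (i < k)%N) gradient (f (p i)) (inner a p x i) =
    (k%:R *: G + psum (centered x) p k) + \sum_(i < n | (i < k)%N)
      (gradient (f (p i)) (inner a p x i) - gradient (f (p i)) x).
  rewrite sumrB /psum sumrB -(big_ord_widen _ (fun=> _)) 1?ltnW// sumr_const card_ord.
  rewrite scaler_nat; apply/rowP => j; rewrite !mxE; ring.
have H1 : enorm (\sum_(i < n | (i < k)%N)
    (gradient (f (p i)) (inner a p x i) - gradient (f (p i)) x)) <= n%:R * (L * D).
  apply: le_trans (enorm_sum _ _ _) _.
  apply: (@le_trans _ _ (\sum_(i < n | (i < k)%N) (L * D))); last first.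
    by rewrite cardk 1?ltnW// ler_wpM2r// mulr_ge0// ltW.
  apply: ler_sum => i ik; apply: le_trans (f_lipschitz pb _ _ _) _.
  by rewrite ler_wpM2l ?(ltW L0)// IH.
have H2 : enorm (k%:R *: G + psum (centered x) p k) <= n%:R * enorm G + b.
  apply: le_trans (enormD _ _) _; apply: lerD; last exact: sb (Ordinal kn).
  by rewrite enormZ ger0_norm// ler_wpM2r ?enorm_ge0.
apply: (@le_trans _ _ (a * (n%:R * enorm G + b + n%:R * (L * D)))).
  by rewrite ler_wpM2l ?(ltW a0)//; apply: le_trans (enormD _ _) _; exact: lerD.
have : 4 * n%:R * L * a * D <= 1 * D by rewrite ler_wpM2r.
have : a * (n%:R * enorm G + b) = 3 / 4 * D by rewrite /D; field.
lra.
Qed.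

(** The epoch is a single step along [g], the sum of the gradients met on the way, and [g] is close
    to n grad f(x) because the inner iterates stay within [D] of [x]. *)
Lemma epoch_descent a b p x : 0 < a -> 4 * n%:R * L * a <= 1 ->
  (forall k : 'I_n, enorm (psum (centered x) p k) <= b) ->
  objective f (rr_epoch f a p x) <= objective f x
    - 7 / 18 * (n%:R * a) * enorm (gradient (objective f) x) ^+ 2
    + 16 / 9 * L ^+ 2 * n%:R * a ^+ 3 * b ^+ 2.
Proof.
move=> a0 aL sb; have dev := inner_dev a0 aL sb.
move: dev; set G := gradient (objective f) x; set D := 4 / 3 * _ * _ => dev.
have b0 : 0 <= b by apply: le_trans (sb (Ordinal (n_gt0 pb))); exact: enorm_ge0.
have D0 : 0 <= D.
  have G0 : 0 <= enorm G := enorm_ge0 G.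
  by rewrite !mulr_ge0 ?addr_ge0 ?mulr_ge0// ltW.
pose g := \sum_(i < n) gradient (f (p i)) (inner a p x i).
have xE : rr_epoch f a p x = x - a *: g.
  by rewrite -inner_last innerE//; congr (_ - _ *: _); apply: eq_bigl => i; rewrite ltn_ord.
have rle : enorm (n%:R *: G - g) <= n%:R * (L * D).
  rewrite scale_gradient_objective -(sum_perm _ p) -sumrB.
  apply: le_trans (enorm_sum _ _ _) _.
  rewrite -(sumr_const_ord n (L * D)); apply: ler_sum => i _.
  apply: le_trans (f_lipschitz pb _ _ _) _.
  by rewrite ler_wpM2l ?(ltW L0)// -enormN opprB dev.
have := descent x (x - a *: g) differentiable_objective objective_gradient_lipschitz.
rewrite -xE xE [x - _ - x]addrAC subrr add0r dotvNr dotvZr enormN enormZ exprMn.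
rewrite real_normK ?num_real// -/G => H; apply: le_trans H _.
(* Polarization: the resulting |g|^2 pays for the second-order term of the descent inequality, so
   only the error [n%:R *: G - g] has to be bounded. *)
have dotE : n%:R * dotv G g = (n%:R ^+ 2 * enorm G ^+ 2 + enorm g ^+ 2
    - enorm (n%:R *: G - g) ^+ 2) / 2.
  rewrite !enorm_sqr !(dotvDl, dotvDr, dotvNl, dotvNr, dotvZl, dotvZr) (dotvC g G).
  by field.
have r2 : enorm (n%:R *: G - g) ^+ 2 <= n%:R ^+ 2 * (L ^+ 2 * D ^+ 2).
  have LD0 : 0 <= n%:R * (L * D) := le_trans (enorm_ge0 _) rle.
  by rewrite -!exprMn lerXn2r ?nnegrE ?enorm_ge0.
(* By (y + z)^2 <= 2y^2 + 2z^2 and (4nLa)^2 <= 1. The coefficient 7/18 of the conclusion is (1 -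
   2/9)/2. *)
have D2 : L ^+ 2 * D ^+ 2 <= 2 / 9 * enorm G ^+ 2 + 32 / 9 * L ^+ 2 * a ^+ 2 * b ^+ 2.
  have : 0 <= L ^+ 2 * a ^+ 2 * (n%:R * enorm G - b) ^+ 2.
    by rewrite -!exprMn sqr_ge0.
  have : (4 * n%:R * L * a) ^+ 2 * enorm G ^+ 2 <= 1 * enorm G ^+ 2.
    by rewrite ler_wpM2r ?sqr_ge0// exprn_ile1// !mulr_ge0// ltW.
  rewrite /D; nra.
have H3 : 0 <= a * (1 - 4 * n%:R * L * a) * enorm g ^+ 2.
  by rewrite mulr_ge0 ?sqr_ge0// mulr_ge0 ?subr_ge0// ltW.
have H4 : 0 <= a * enorm g ^+ 2 by rewrite mulr_ge0 ?sqr_ge0 ?ltW.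
rewrite -(ler_pM2l n0).
have H5 : a * (n%:R * dotv G g) >= a * ((n%:R ^+ 2 * enorm G ^+ 2 + enorm g ^+ 2
    - n%:R ^+ 2 * (2 / 9 * enorm G ^+ 2 + 32 / 9 * L ^+ 2 * a ^+ 2 * b ^+ 2)) / 2).
  rewrite ler_pM2l// dotE ler_pM2r// lerD2l lerN2; apply: le_trans r2 _.
  by rewrite ler_pM2l ?exprn_gt0.
move: H3 H4 H5; rewrite !mulrDr !mulrN.
set u := enorm G ^+ 2; set w := enorm g ^+ 2; set t := dotv G g.
lra.
Qed.

Definition good_perm l x p : bool := [forall k : 'I_n,
  enorm (psum (centered x) p k) <= 3 * Num.sqrt (\sum_i enorm (centered x i) ^+ 2) * l].

(** Union bound over the [n] prefix lengths. *)
Lemma card_bad_perm l x :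
  #|[set p | ~~ good_perm l x p]%SET|%:R <= n%:R * (8 * expR (- l)) * n`!%:R.
Proof.
pose S k := [set p : 'S_n | 3 * Num.sqrt (\sum_i enorm (centered x i) ^+ 2) * l
  < enorm (psum (centered x) p k)]%SET.
apply: (@le_trans _ _ (\sum_(k < n) #|S k|)%:R).
  rewrite ler_nat; apply: (@leq_trans #|(\bigcup_(k < n) S k)%SET|).
    apply/subset_leq_card/fintype.subsetP => p; rewrite !inE negb_forall => /existsP[k].
    by rewrite -ltNge => pk; apply/finset.bigcupP; exists k; rewrite ?inE.
  elim/big_rec2: _ => [|k m A _ IH]; first by rewrite cards0.
  by apply: leq_trans (leq_card_setU _ _) _; rewrite leq_add2l.
rewrite natr_sum -mulrA -(sumr_const_ord n (_ * _)).
by apply: ler_sum => k _; apply: card_psum_gt; rewrite ?sum_centered// ltnW.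
Qed.

(** For a good permutation b^2 = 9 l^2 v with v <= n A z, where z is the potential at [x]; the
    second step size condition makes the error term of [epoch_descent] at most z/(2T). *)
Lemma potential_step (T : nat) a l p x : (0 < T)%N -> 0 < a ->
  4 * n%:R * L * a <= 1 ->
  32 * L ^+ 2 * constA L * l ^+ 2 * n%:R ^+ 2 * T%:R * a ^+ 3 <= 1 ->
  good_perm l x p ->
  potential (rr_epoch f a p x)
    + 7 / 18 * (n%:R * a) * enorm (gradient (objective f) x) ^+ 2
  <= (1 + (2 * T%:R)^-1) * potential x.
Proof.
move=> T0 a0 aL aT /forallP good.
have := epoch_descent a0 aL good.
set v := \sum_i _; set E := objective f (rr_epoch _ _ _ _); set G := enorm _ ^+ 2.
rewrite !exprMn sqr_sqrtr; last by apply: sumr_ge0 => i _; exact: sqr_ge0.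
have Tr0 : 0 < T%:R :> R by rewrite ltr0n.
have v1 : 16 * L ^+ 2 * n%:R * a ^+ 3 * l ^+ 2 * v <= (2 * T%:R)^-1 * potential x.
  apply: (@le_trans _ _ (16 * L ^+ 2 * n%:R * a ^+ 3 * l ^+ 2 * (n%:R * constA L * potential x))).
    rewrite ler_wpM2l ?sum_centered_sqr//.
    by rewrite mulr_ge0 ?sqr_ge0// mulr_ge0 ?exprn_ge0 ?(ltW a0)// mulr_ge0// mulr_ge0 ?sqr_ge0.
  rewrite [leRHS]mulrC ler_pdivlMr ?mulr_gt0//.
  rewrite -[leRHS]mul1r.
  apply: le_trans (ler_wpM2r (potential_ge0 x) aT).
  by rewrite le_eqVlt; apply/orP; left; apply/eqP; ring.
rewrite [(1 + (2 * _)^-1) * _]mulrDl mul1r {1 2}/potential -/E; lra.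
Qed.

End Epoch.

(** * The whole run and the step size *)

Section Run.
Context {R : realType} {d n : nat}.
Variables (f : 'I_n -> 'rV[R]_d -> R) (L fbar : R) (fbars : 'I_n -> R).
Hypothesis pb : finite_sum_problem f L fbar fbars.
Implicit Types (x : 'rV[R]_d) (a l : R).

Let n0 : 0 < n%:R :> R. Proof. by rewrite ltr0n (n_gt0 pb). Qed.

Let L0 : 0 < L. Proof. exact: L_gt0 pb. Qed.

Lemma constFE x : constF f L fbar fbars x = 3 * potential f L fbar fbars x.
Proof. by rewrite /constF /potential; ring. Qed.

Lemma constF_ge0 x : 0 <= constF f L fbar fbars x.
Proof. by rewrite constFE mulr_ge0 ?(potential_ge0 pb). Qed.

Lemma mean_sq_grad_le (T : nat) a l (p : nat -> 'S_n) x0 : (0 < T)%N -> 0 < a ->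
  4 * n%:R * L * a <= 1 ->
  32 * L ^+ 2 * constA L * l ^+ 2 * n%:R ^+ 2 * T%:R * a ^+ 3 <= 1 ->
  (forall t, (t < T)%N -> good_perm f l (rr f (fun=> a) p x0 t) (p t)) ->
  mean_sq_grad f (rr f (fun=> a) p x0) T <=
    12 / 7 * constF f L fbar fbars x0 / (n%:R * a * T%:R).
Proof.
move=> T0 a0 aL aT good; set x := rr _ _ _ _.
have Tr0 : 0 < T%:R :> R by rewrite ltr0n.
pose q : R := 1 + (2 * T%:R)^-1.
have q1 : 1 <= q by rewrite lerDl invr_ge0 mulr_ge0.
pose h := 7 / 18 * (n%:R * a).
pose G t := enorm (gradient (objective f) (x t)) ^+ 2.
have h0 : 0 < h by rewrite !mulr_gt0.
(* The gradient terms already collected may be multiplied by [q >= 1], so the recursion telescopes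
   with a single factor [q ^+ t]. *)
have tele t : (t <= T)%N -> potential f L fbar fbars (x t) + h * \sum_(s < t) G s
    <= q ^+ t * potential f L fbar fbars x0.
  elim: t => [|t IH] tT; first by rewrite big_ord0 mulr0 addr0 expr0 mul1r.
  rewrite big_ord_recr /= exprS -mulrA.
  apply: le_trans (ler_wpM2l (le_trans ler01 q1) (IH (ltnW tT))).
  have := potential_step pb T0 a0 aL aT (good t tT).
  rewrite -/x -/(rr _ _ _ _ t.+1) -/x -/(G t) -/h -/q => st.
  have hS : 0 <= h * \sum_(s < t) G s.
    by rewrite mulr_ge0 ?(ltW h0)// sumr_ge0// => s _; exact: sqr_ge0.
  have : 1 * (h * \sum_(s < t) G s) <= q * (h * \sum_(s < t) G s) by rewrite ler_wpM2r.
  rewrite /x /= -/x; lra.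
(* [q ^+ T] is at most exp(1/2), and [expR_le_quad] at 1/2 gives 2. *)
have qT : q ^+ T <= 2.
  apply: (@le_trans _ _ (expR (2 * T%:R)^-1 ^+ T)).
    by rewrite lerXn2r ?nnegrE ?expR_ge0 ?(le_trans ler01)// expR_ge1Dx.
  rewrite -expRM_natl; apply: le_trans (expR_le_quad _) _.
    by rewrite invfM mulrCA divff ?gt_eqF//; lra.
  by rewrite invfM mulrCA divff ?gt_eqF//; lra.
have := tele T (leqnn _).
have z0 := potential_ge0 pb x0; have zT := potential_ge0 pb (x T).
have q2 := ler_wpM2r z0 qT => H.
have {H} H : h * \sum_(s < T) G s <= 2 * potential f L fbar fbars x0 by lra.
rewrite /mean_sq_grad -/(G _) mulrC ler_pdivrMr//.
rewrite invfM mulrA divfK ?gt_eqF// ler_pdivlMr ?mulr_gt0//.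
by rewrite constFE; move: H; rewrite /h /G; lra.
Qed.

End Run.

Lemma powR13_cube {R : realType} (x : R) : 0 <= x -> (x `^ (1 / 3)) ^+ 3 = x.
Proof.
move=> x0; rewrite -powR_mulrn ?powR_ge0// -powRrM.
by rewrite (_ : 1 / 3 * 3%:R = 1) ?powRr1//; field.
Qed.

Lemma powR23_13 {R : realType} (x : R) : 0 <= x -> (x ^+ 2) `^ (1 / 3) = x `^ (2 / 3).
Proof.
move=> x0; rewrite -(powR_mulrn 2 x0) -powRrM.
by rewrite (_ : 2%:R * (1 / 3) = 2 / 3)//; field.
Qed.

Lemma powR13M23 {R : realType} (x : R) : 0 < x -> x `^ (1 / 3) * x `^ (2 / 3) = x.
Proof.
move=> x0; rewrite -powRD; last by rewrite gt_eqF ?implybT.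
by rewrite (_ : 1 / 3 + 2 / 3 = 1) ?powRr1 ?ltW//; field.
Qed.

(** * Properties of the prescribed step size *)

Section StepSizeBounds.
Context {R : realType}.
Variables (L delta : R) (n T : nat).
Hypotheses (L0 : 0 < L) (n0 : (0 < n)%N) (T0 : (0 < T)%N) (delta01 : 0 < delta < 1).

Let nr0 : 0 < n%:R :> R. Proof. by rewrite ltr0n. Qed.

Let Tr0 : 0 < T%:R :> R. Proof. by rewrite ltr0n. Qed.

Let l := log_factor n T delta.

Let delta0 : 0 < delta. Proof. by case/andP: delta01. Qed.

Let arg0 : 0 < 8 * n%:R * T%:R / delta.
Proof. by rewrite divr_gt0// !mulr_gt0. Qed.

Lemma log_factor_gt0 : 0 < l.
Proof.
rewrite /l /log_factor ln_gt0// ltr_pdivlMr//.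
case/andP: delta01 => _ d1; rewrite mul1r; apply: (lt_le_trans d1).
by rewrite -!natrM ler1n !muln_gt0 n0 T0.
Qed.

(** The argument 8nT/delta of the logarithm is what makes the failure probability of one epoch
    delta/T. *)
Lemma expRN_log_factor : n%:R * (8 * expR (- l)) = delta / T%:R.
Proof.
rewrite expRN /l /log_factor lnK ?posrE//; field.
by rewrite !gt_eqF.
Qed.

Let c := (constC1 L n T delta * n%:R ^+ 2 * T%:R) `^ (1 / 3).

Let C1_gt0 : 0 < constC1 L n T delta * n%:R ^+ 2 * T%:R.
Proof.
by rewrite !mulr_gt0 ?exprn_gt0 ?log_factor_gt0.
Qed.

Let c0 : 0 < c. Proof. exact: powR_gt0. Qed.

Lemma step_size_gt0 : 0 < step_size L n T delta.
Proof. by rewrite lt_min !invr_gt0 c0 !mulr_gt0. Qed.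

Lemma step_size_le1 : 4 * n%:R * L * step_size L n T delta <= 1.
Proof.
have u0 : 0 < 4 * n%:R * L by rewrite !mulr_gt0.
by rewrite -ler_pdivlMl// mulr1 /step_size ge_min lexx.
Qed.

Lemma step_size_le2 : 32 * L ^+ 2 * constA L * l ^+ 2 * n%:R ^+ 2 * T%:R *
  step_size L n T delta ^+ 3 <= 1.
Proof.
rewrite -/(constC1 L n T delta) -(powR13_cube (ltW C1_gt0)) -/c -exprMn.
rewrite exprn_ile1// ?mulr_ge0 ?(ltW c0) ?(ltW step_size_gt0)//.
by rewrite -ler_pdivlMl// mulr1 /step_size ge_min lexx orbT.
Qed.

(** Each branch of the minimum yields one term of the maximum. The constants are 12/7 * 4 = 48/7 and
    12/7 * 32^(1/3) <= 48/7, below 45 and 35. *)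
Lemma step_size_rate (F : R) : 0 <= F ->
  12 / 7 * F / (n%:R * step_size L n T delta * T%:R) <= Num.max (45 * L * F / T%:R)
    (35 * L `^ (2 / 3) * constA L `^ (1 / 3) * F * l `^ (2 / 3)
      / (n%:R `^ (1 / 3) * T%:R `^ (2 / 3))).
Proof.
move=> F0; have l0 := log_factor_gt0.
rewrite /step_size -/c le_max; apply/orP; case: (leP (4 * n%:R * L)^-1 c^-1) => _.
  left; have -> : 12 / 7 * F / (n%:R * (4 * n%:R * L)^-1 * T%:R) = 48 / 7 * (L * F / T%:R).
    by field; rewrite !gt_eqF.
  have -> : 45 * L * F / T%:R = 45 * (L * F / T%:R) by ring.
  by rewrite ler_wpM2r ?mulr_ge0 ?invr_ge0 ?(ltW L0)//; lra.
right.
have A0 : 0 <= constA L by rewrite mulr_ge0// ltW.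
set M := L `^ (2 / 3) * constA L `^ (1 / 3) * l `^ (2 / 3).
have M0 : 0 <= M by rewrite !mulr_ge0 ?powR_ge0.
have cE : c = 32 `^ (1 / 3) * M * (n%:R `^ (2 / 3) * T%:R `^ (1 / 3)).
  rewrite /c /constC1 -/l.
  rewrite /M -!powR23_13 ?(ltW L0) ?(ltW l0) ?(ltW nr0)//.
  move: (L ^+ 2) (l ^+ 2) (n%:R ^+ 2 : R) (sqr_ge0 L) (sqr_ge0 l) (sqr_ge0 (n%:R : R)).
  move: (constA L) A0 => A A0 L2 l2 n2 ? ? ?.
  by rewrite !powRM ?mulr_ge0//; ring.
have -> : 12 / 7 * F / (n%:R * c^-1 * T%:R) =
   (12 / 7 * 32 `^ (1 / 3)) * (M * F / (n%:R `^ (1 / 3) * T%:R `^ (2 / 3))).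
  have -> : 12 / 7 * F / (n%:R * c^-1 * T%:R) = 12 / 7 * F * c / (n%:R * T%:R).
    by field; rewrite !gt_eqF.
  rewrite cE -{2}(powR13M23 nr0) -{2}(powR13M23 Tr0); field.
  by rewrite !gt_eqF ?powR_gt0.
have r32 : 32 `^ (1 / 3) <= 4 :> R.
  by rewrite -(ler_pXn2r (n := 3)) ?nnegrE ?powR_ge0// powR13_cube//; lra.
have -> : 35 * L `^ (2 / 3) * constA L `^ (1 / 3) * F * l `^ (2 / 3)
      / (n%:R `^ (1 / 3) * T%:R `^ (2 / 3)) =
    35 * (M * F / (n%:R `^ (1 / 3) * T%:R `^ (2 / 3))) by rewrite /M; ring.
rewrite ler_wpM2r//; last by lra.
by rewrite divr_ge0 ?mulr_ge0 ?powR_ge0.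
Qed.

End StepSizeBounds.

(** * Probability of the good event *)

Section FiniteValued.
Context {R : realType} {dO : measure_display} {Omega : measurableType dO}.
Variables (P : probability Omega R) (I : finType) (X : Omega -> I).
Hypothesis mX : forall i, measurable (X @^-1` [set i]).

Let fibresE (A : pred I) :
  [set w | A (X w)] = \bigcup_(i in [set` enum A]) X @^-1` [set i].
Proof.
rewrite -preimage_bigcup; apply/seteqP; split => [w Aw|w [i]] /=.
  by exists (X w) => //=; rewrite mem_enum.
by rewrite mem_enum => Ai ->.
Qed.

Lemma measurable_finite_valued (A : pred I) : measurable [set w | A (X w)].
Proof.
rewrite fibresE; apply: fin_bigcup_measurable => // i _; exact: mX.
Qed.

Lemma probability_finite_valued (A : pred I) :
  P [set w | A (X w)] = (\sum_(i | A i) P (X @^-1` [set i]))%E.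
Proof.
rewrite fibresE measure_fin_bigcup//; last first.
- by move=> i j _ _ [w [/= <- <-]].
rewrite -fsbig_seq ?enum_uniq// big_enum /=; exact: eq_bigl.
Qed.

End FiniteValued.

Definition history (Omega : Type) n (perms : nat -> Omega -> 'S_n) t w :
  {ffun 'I_t -> 'S_n} := [ffun k : 'I_t => perms k w].

Section Sampling.
Context {R : realType} {dO : measure_display} {Omega : measurableType dO}.
Variables (P : probability Omega R) (n T : nat) (perms : nat -> Omega -> 'S_n).
Hypothesis samp : rr_sampling P T perms.

Lemma measurable_history t : (t <= T)%N ->
  forall h, measurable (history perms t @^-1` [set h]).
Proof.
move=> tT h.
have -> : history perms t @^-1` [set h] =
    \bigcap_(k in [set` enum 'I_t]) (perms k @^-1` [set h k]).
  apply/seteqP; split => [w /= <- k _ /=|w hw /=]; first by rewrite ffunE.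
  by apply/ffunP => k; rewrite ffunE; apply: hw; rewrite /= mem_enum.
apply: fin_bigcap_measurable => // k _.
by apply: (sampling_measurable samp); apply: leq_trans tT.
Qed.

(** The bad set may depend on the past. Independence and uniformity give the pair (history, draw)
    the weight P(h) / n! at each (h, p), so each history contributes at most e P(h), and these
    weights sum to [e]. *)
Lemma probability_bad_draw t (A : {ffun 'I_t -> 'S_n} -> pred 'S_n) (e : R) :
  (t < T)%N -> (forall h, #|[set p | A h p]%SET|%:R <= e * n`!%:R) ->
  (P [set w | A (history perms t w) (perms t w)] <= e%:E)%E.
Proof.
move=> tT Ae.
pose X w := (history perms t w, perms t w).
have fibreE h p : X @^-1` [set (h, p)] =
    [set w | perms t w \in [set p]%SET] `&` [set w | history perms t w \in [set h]%SET].
  apply/seteqP; split => w; rewrite /= !inE /X.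
    by case=> -> ->.
  by case=> /eqP -> /eqP ->.
have histE h : [set w | history perms t w \in [set h]%SET] = history perms t @^-1` [set h].
  by apply/seteqP; split => w; rewrite /= inE => /eqP.
have permE p : [set w | perms t w \in [set p]%SET] = perms t @^-1` [set p].
  by apply/seteqP; split => w; rewrite /= inE => /eqP.
have mh := measurable_history (ltnW tT).
have mX i : measurable (X @^-1` [set i]).
  case: i => h p; rewrite fibreE histE permE; apply: measurableI => //.
  exact: (sampling_measurable samp).
have PX h p : P (X @^-1` [set (h, p)]) = (P (history perms t @^-1` [set h]) * (n`!%:R^-1)%:E)%E.
  rewrite fibreE (sampling_indep samp)// histE permE (sampling_uniform samp)//.
  by rewrite muleC.
rewrite -[X in P X]/[set w | (fun i => A i.1 i.2) (X w)].
rewrite (probability_finite_valued P mX).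
have -> : (\sum_(i | A i.1 i.2) P (X @^-1` [set i]) =
    \sum_h \sum_(p | A h p) P (X @^-1` [set (h, p)]))%E.
  by rewrite pair_big_dep; apply: eq_bigr => -[].
have hist1 : (\sum_h P (history perms t @^-1` [set h]) = 1)%E.
  rewrite -(probability_finite_valued P mh xpredT) -[RHS](probability_setT P).
  by congr (P _); apply/seteqP.
rewrite -[leRHS]mul1e -hist1 ge0_sume_distrl; last by move=> h _; exact: measure_ge0.
apply: lee_sum => h _.
under eq_bigr do rewrite PX.
rewrite -ge0_sume_distrr; last by move=> p _; rewrite lee_fin invr_ge0.
rewrite lee_wpmul2l ?measure_ge0// sumEFin lee_fin sumr_const.
rewrite -[_ *+ _]mulr_natl ler_pdivrMr ?ltr0n ?fact_gt0//.
apply: le_trans (Ae h); rewrite ler_nat.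
by apply/eq_leq/eq_card => p; rewrite inE.
Qed.

End Sampling.

(** * Iterates as functions of the past permutations *)

Section RunDependence.
Context {R : realType} {d n : nat}.
Variables (f : 'I_n -> 'rV[R]_d -> R) (alpha : nat -> R) (x0 : 'rV[R]_d).

Lemma eq_rr t (p q : nat -> 'S_n) : (forall s, (s < t)%N -> p s = q s) ->
  rr f alpha p x0 t = rr f alpha q x0 t.
Proof.
elim: t => [//|t IH] pq.
rewrite /= (pq t (ltnSn t)) IH// => s st.
by apply: pq; exact: ltnW.
Qed.

(** Turns a history into an infinite sequence that [rr] accepts; the identity at positions from [t]
    on is never read by the first [t] epochs. *)
Definition extend t (h : {ffun 'I_t -> 'S_n}) (s : nat) : 'S_n :=
  if insub s is Some k then h k else 1%g.

Lemma rr_extend Omega (perms : nat -> Omega -> 'S_n) t s w : (s <= t)%N ->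
  rr f alpha (extend (history perms t w)) x0 s = rr f alpha (perms^~ w) x0 s.
Proof.
move=> st; apply: eq_rr => k ks; rewrite /extend insubT ?(leq_trans ks)// => kt.
by rewrite ffunE.
Qed.

Lemma mean_sq_grad_extend Omega (perms : nat -> Omega -> 'S_n) t w :
  mean_sq_grad f (rr f alpha (extend (history perms t w)) x0) t =
  mean_sq_grad f (rr f alpha (perms^~ w) x0) t.
Proof.
rewrite /mean_sq_grad; congr (_ * _); apply: eq_bigr => s _.
by rewrite (rr_extend _ _ (ltnW (ltn_ord s))).
Qed.

End RunDependence.

Section HighProbability.
Context {R : realType} {d n : nat}.
Variables (f : 'I_n -> 'rV[R]_d -> R) (L fbar : R) (fbars : 'I_n -> R).
Hypothesis pb : finite_sum_problem f L fbar fbars.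

Lemma probability_rr_bound (T : nat) (delta c : R) x0 (dO : measure_display)
    (Omega : measurableType dO) (P : probability Omega R)
    (perms : nat -> Omega -> 'S_n) :
  (0 < T)%N -> 0 < delta < 1 -> rr_sampling P T perms ->
  12 / 7 * constF f L fbar fbars x0 / (n%:R * step_size L n T delta * T%:R) <= c ->
  ((1 - delta)%:E <= P [set w |
     (mean_sq_grad f (rr f (fun=> step_size L n T delta) (perms^~ w) x0) T <= c)%R])%E.
Proof.
move=> T0 delta01 samp Fc; set a := step_size L n T delta; set E := [set w | _].
pose l := log_factor n T delta.
(* The iterate is recomputed from the history alone, which puts the bad event of epoch [t] into the
   form of [probability_bad_draw]. *)
pose A t (h : {ffun 'I_t -> 'S_n}) p := ~~ good_perm f l (rr f (fun=> a) (extend h) x0 t) p.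
pose B t := [set w | A t (history perms t w) (perms t w)].
have mB t : (t < T)%N -> measurable (B t).
  move=> tT; pose X w := (history perms t w, perms t w).
  rewrite -[B t]/[set w | (fun i => A t i.1 i.2) (X w)].
  apply: measurable_finite_valued => -[h p].
  rewrite [X in measurable X](_ : _ = history perms t @^-1` [set h] `&` perms t @^-1` [set p]).
    apply: measurableI; first exact: (measurable_history samp (ltnW tT)).
    exact: (sampling_measurable samp).
  by apply/seteqP; split => w /=; [case=> -> -> | case=> <- <-].
have PB t : (t < T)%N -> (P (B t) <= (delta / T%:R)%:E)%E.
  move=> tT; apply: (probability_bad_draw samp) => // h.
  rewrite -(expRN_log_factor (n_gt0 pb) T0 delta01).
  exact: (card_bad_perm pb).
pose U := \big[setU/set0]_(t < T) B t.
have mU : measurable U by apply: bigsetU_measurable => t _; exact: mB.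
have PU : (P U <= delta%:E)%E.
  apply: le_trans (content_subadditive P (n := T) (F := B) _ mU _) _ => //.
  apply: (@le_trans _ _ (\sum_(t < T) (delta / T%:R)%:E)%E).
    by apply: lee_sum => t _; exact: PB.
  by rewrite sumEFin lee_fin sumr_const_ord mulrC divfK// pnatr_eq0 -lt0n.
(* Monotonicity of [P] requires a measurable event; [E] is determined by the finite-valued history
   up to [T]. *)
have mE : measurable E.
  pose Q : pred {ffun 'I_T -> 'S_n} :=
    fun h => mean_sq_grad f (rr f (fun=> a) (extend h) x0) T <= c.
  rewrite (_ : E = [set w | Q (history perms T w)]); last first.
    by apply/seteqP; split => w; rewrite /E /Q /= mean_sq_grad_extend.
  exact: (measurable_finite_valued (measurable_history samp (leqnn T)) Q).
apply: (@le_trans _ _ (P (~` U))).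
  by rewrite probability_setC// EFinB; apply: leeB.
apply: le_measure; rewrite ?inE//; first exact: measurableC.
move=> w Uw; rewrite /E /=; apply: le_trans Fc.
have n0 := n_gt0 pb; have L0 := L_gt0 pb.
apply: (mean_sq_grad_le pb (l := l)) => //.
- exact: step_size_gt0.
- exact: step_size_le1.
- exact: step_size_le2.
- move=> t tT; apply/negPn/negP => bad; apply: Uw.
  have Bw : B t w by rewrite /B /mkset /A (rr_extend _ _ _ _ _ (leqnn t)); exact: bad.
  by rewrite /U -bigcup_mkord; exists t; [exact: tT|exact: Bw].
Qed.

End HighProbability.

(** * Complexity *)

Section Complexity.
Context {R : realType}.

Lemma ln_le_sqrt (x : R) : 0 < x -> ln (16 * x ^+ 2) <= 8 * x.
Proof.
move=> x0; have -> : 16 * x ^+ 2 = (4 * x) ^+ 2 by ring.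
rewrite lnXn ?mulr_gt0// mulr2n.
have x40 : 0 < 4 * x by rewrite mulr_gt0.
by have := ltW (ln_sublinear x40); lra.
Qed.

(* With [q = 1 + ln u] and [n T ~ w ^ 2 m q], all of [8], [n T] and [1 / delta] are
   absorbed: [ln (8 n T / delta) <= ln (16 w ^ 2) + 4 q <= 12 w q]. *)
Lemma log_budget (w m u q N r : R) : 1 <= w -> 1 <= u -> 0 < m -> m <= u ^+ 2 ->
  q = 1 + ln u -> 0 < N -> N <= 2 * w ^+ 2 * m * q -> 0 < r -> r <= u ->
  ln (8 * N * r) <= 12 * w * q.
Proof.
move=> w1 u1 m0 mu qE N0 NQ r0 ru.
have w0 : 0 < w by apply: lt_le_trans w1.
have u0 : 0 < u by apply: lt_le_trans u1.
have lu0 : 0 <= ln u by apply: ln_ge0.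
have q1 : 1 <= q by rewrite qE lerDl.
have q0 : 0 < q by apply: lt_le_trans q1.
have : ln (8 * N * r) <= ln (16 * w ^+ 2 * (u ^+ 2 * q * u)).
  rewrite ler_ln ?posrE ?mulr_gt0 ?exprn_gt0//.
  apply: (@le_trans _ _ (8 * (2 * w ^+ 2 * m * q) * r)).
    by rewrite ler_wpM2r ?(ltW r0)// ler_wpM2l.
  have -> : 8 * (2 * w ^+ 2 * m * q) * r = 16 * w ^+ 2 * (m * q * r) by ring.
  rewrite ler_wpM2l ?mulr_ge0 ?exprn_ge0 ?(ltW w0)//.
  by rewrite ler_pM ?mulr_ge0 ?(ltW m0) ?(ltW q0) ?(ltW r0)// ler_wpM2r ?(ltW q0).
have -> : ln (16 * w ^+ 2 * (u ^+ 2 * q * u)) =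
    ln (16 * w ^+ 2) + (ln u + ln u + ln q + ln u).
  have W0 : 0 < 16 * w ^+ 2 by rewrite mulr_gt0 ?exprn_gt0.
  by move: (16 * _) W0 => W W0; rewrite expr2 !lnM ?posrE ?mulr_gt0.
(* The four last logarithms are each at most [q], and 8w + 4q <= 12wq because [w] and [q] are at
   least 1. *)
move=> H; have := ln_le_sqrt w0; have := ltW (ln_sublinear q0).
have : 8 * w * 1 <= 8 * w * q by rewrite ler_wpM2l ?mulr_ge0 ?(ltW w0).
have : 1 * q <= w * q by rewrite ler_wpM2r ?(ltW q0).
lra.
Qed.


(** Cubing the conclusion and squaring the hypothesis both give K^3 l^2 <= e^6 n T^2. *)
Lemma powR13_le (K l n T e : R) : 0 <= K -> 0 <= l -> 0 < n -> 0 < T -> 0 <= e ->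
  Num.sqrt (K ^+ 3) * l <= e ^+ 3 * (Num.sqrt n * T) ->
  K * l `^ (2 / 3) / (n `^ (1 / 3) * T `^ (2 / 3)) <= e ^+ 2.
Proof.
move=> K0 l0 n0 T0 e0 H.
rewrite ler_pdivrMr ?mulr_gt0 ?powR_gt0//.
rewrite -(ler_pXn2r (n := 3)) ?nnegrE ?mulr_ge0 ?powR_ge0 ?exprn_ge0//.
rewrite !exprMn -!powR23_13 ?(ltW T0)// !powR13_cube ?exprn_ge0 ?(ltW n0) ?(ltW T0)//.
have := lerXn2r 2 _ _ H; rewrite !nnegrE !mulr_ge0 ?exprn_ge0 ?sqrtr_ge0 ?(ltW T0)//.
move=> /(_ isT isT); rewrite !exprMn !sqr_sqrtr ?exprn_ge0 ?(ltW n0)//.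
by have -> : e ^+ 3 * e ^+ 3 = e ^+ 2 * (e ^+ 2 * e ^+ 2) by ring.
Qed.

End Complexity.

Theorem theorem3p3 (R : realType) :
  (forall (d n : nat) (f : 'I_n -> 'rV[R]_d -> R) (L fbar : R)
          (fbars : 'I_n -> R) (x0 : 'rV[R]_d) (T : nat) (delta : R),
     finite_sum_problem f L fbar fbars ->
     (1 <= T)%N -> 0 < delta < 1 ->
     forall (dO : measure_display) (Omega : measurableType dO)
            (P : probability Omega R) (perms : nat -> Omega -> 'S_n),
       rr_sampling P T perms ->
       ((1 - delta)%:E <=
        P [set w |
             (mean_sq_grad f
               (rr f (fun _ => step_size L n T delta) (perms^~ w) x0) T
             <= Num.max
                  (45 * L * constF f L fbar fbars x0 / T%:R)
                  (35 * L `^ (2 / 3) * constA L `^ (1 / 3)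
                      * constF f L fbar fbars x0
                      * log_factor n T delta `^ (2 / 3)
                   / (n%:R `^ (1 / 3) * T%:R `^ (2 / 3))))%R])%E)
  /\
  (forall L Delta B : R, exists C : R,
     forall (d n : nat) (f : 'I_n -> 'rV[R]_d -> R) (fbar : R)
            (fbars : 'I_n -> R) (x0 : 'rV[R]_d) (delta eps : R),
       finite_sum_problem f L fbar fbars ->
       objective f x0 - fbar = Delta ->
       constB L fbar fbars = B ->
       0 < delta < 1 -> 0 < eps <= 1 ->
       exists T : nat,
         [/\ (1 <= T)%N,
             (n * T)%:R <=
               C * Num.max (Num.sqrt n%:R * eps ^- 3) (n%:R * eps ^- 2)
                 * (1 + ln (Num.sqrt n%:R * eps ^- 3 / delta))
           & forall (dO : measure_display) (Omega : measurableType dO)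
                    (P : probability Omega R) (perms : nat -> Omega -> 'S_n),
               rr_sampling P T perms ->
               ((1 - delta)%:E <=
                P [set w |
                     (mean_sq_grad f
                       (rr f (fun _ => step_size L n T delta) (perms^~ w) x0) T
                     <= eps ^+ 2)%R])%E]).
Proof.
split=> [d n f L fbar fbars x0 T delta pb T1 delta01 dO Omega P perms samp|L Delta B].
  apply: (probability_rr_bound pb T1 delta01 samp).
  apply: (step_size_rate (L_gt0 pb) (n_gt0 pb) T1 delta01).
  exact: (constF_ge0 pb).
pose F := 3 * Delta + 3 * B / constA L.
pose K := 35 * L `^ (2 / 3) * constA L `^ (1 / 3) * F.
(* Fixed before the problem is given, so built from [L], [Delta] and [B] only. The summands serve
   the logarithmic rate, the 1/T rate and [1 <= w]; the 2 in the constant below pays for rounding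
   [T] up. *)
pose w := 12 * Num.sqrt (K ^+ 3) + 45 * L * F + 1.
exists (2 * w ^+ 2) => d n f fbar fbars x0 delta eps pb fD fB delta01 /andP[e0 e1].
have FE : constF f L fbar fbars x0 = F by rewrite /constF fD fB.
have F0 : 0 <= F by rewrite -FE; exact: (constF_ge0 pb).
have L0 := L_gt0 pb; have n0 := n_gt0 pb; have /andP[d0 d1] := delta01.
have K0 : 0 <= K by rewrite mulr_ge0// !mulr_ge0 ?powR_ge0.
have LF0 : 0 <= 45 * L * F by rewrite mulr_ge0// mulr_ge0 ?(ltW L0).
have sK0 : 0 <= Num.sqrt (K ^+ 3) := sqrtr_ge0 _.
have nr1 : 1 <= n%:R :> R by rewrite ler1n.
have nr0 : 0 < n%:R :> R by rewrite ltr0n.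
have sn1 : 1 <= Num.sqrt n%:R :> R by rewrite -[leLHS]sqrtr1 ler_wsqrtr.
have ek1 k : 1 <= eps ^- k.
  by rewrite invf_ge1 ?exprn_gt0// exprn_ile1 ?(ltW e0).
set s := Num.sqrt n%:R * eps ^- 3; set m := Num.max _ _.
have s1 : 1 <= s by rewrite -[leLHS]mulr1 ler_pM.
have s0 : 0 < s by apply: lt_le_trans s1.
set u := s / delta; set q := 1 + ln u.
have r1 : 1 <= delta^-1 by rewrite invf_ge1 ?(ltW d1).
have r0 : 0 < delta^-1 by rewrite invr_gt0.
have ru : delta^-1 <= u by rewrite -[leLHS]mul1r ler_wpM2r ?(ltW r0).
have su : s <= u by rewrite -[leLHS]mulr1 ler_wpM2l ?(ltW s0).
have u1 : 1 <= u := le_trans s1 su.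
have q1 : 1 <= q by rewrite lerDl ln_ge0.
have sm : s <= m by rewrite le_max lexx.
have nm : n%:R * eps ^- 2 <= m by rewrite le_max lexx orbT.
have m0 : 0 < m by apply: lt_le_trans sm.
(* Both terms of the maximum are at most s^2 = n eps^-6, and s <= u. *)
have mu2 : m <= u ^+ 2.
  apply: (@le_trans _ _ (s ^+ 2)); last first.
    by rewrite lerXn2r ?nnegrE ?(ltW s0) ?(le_trans ler01 u1).
  rewrite ge_max expr2 ler_peMr ?(ltW s0)//= /s -expr2 exprMn sqr_sqrtr ?(ltW nr0)//.
  rewrite ler_wpM2l ?(ltW nr0)// -exprVn -exprVn -exprM ler_weXn2l// -[eps^-1]expr1 exprVn.
  exact: ek1.
have w1 : 1 <= w by rewrite lerDr addr_ge0// mulr_ge0.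
have w0 : 0 < w by apply: lt_le_trans w1.
have q0 : 0 < q by apply: lt_le_trans q1.
have w2 : w <= w ^+ 2 by rewrite expr2 ler_peMr ?(ltW w0).
(* The real number of epochs for a budget of w^2 m q gradients; [1 <= x] ensures that the rounded
   value [T] stays below 2x. *)
pose x := w ^+ 2 * m * q / n%:R.
have x1 : 1 <= x.
  rewrite ler_pdivlMr// mul1r; apply: (@le_trans _ _ m).
    by apply: le_trans nm; rewrite ler_peMr ?(ltW nr0).
  by rewrite -[leLHS]mulr1 ler_pM ?(ltW m0)// ler_peMl ?(ltW m0)// (le_trans w1).
have x0' : 0 <= x := le_trans ler01 x1.
pose T := (Num.truncn x).+1.
have xT : x <= T%:R := ltW (truncnS_gt x).
have Tx : T%:R <= 2 * x.
  have : (Num.truncn x)%:R <= x by rewrite truncn_le.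
  rewrite /T -natr1; lra.
have Tr0 : 0 < T%:R :> R by rewrite ltr0n.
have NE : n%:R * x = w ^+ 2 * m * q by rewrite /x mulrC divfK ?gt_eqF.
have Nle : (n * T)%:R <= 2 * w ^+ 2 * m * q.
  rewrite natrM; have := ler_wpM2l (ltW nr0) Tx; lra.
have Nge : w ^+ 2 * m * q <= (n * T)%:R by rewrite natrM -NE ler_wpM2l ?(ltW nr0).
exists T; split => // dO Omega P perms samp.
apply: (probability_rr_bound pb _ delta01 samp) => //.
apply: le_trans (step_size_rate L0 n0 _ delta01 (constF_ge0 pb x0)) _ => //.
set l := log_factor n T delta; rewrite FE ge_max; apply/andP; split.
  (* The 1/T term needs T >= 45 L F eps^-2, which follows from w^2 >= 45 L F, m >= n eps^-2 and q >=
     1. *)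
  rewrite ler_pdivrMr// -ler_pdivrMl ?exprn_gt0//.
  apply: le_trans xT; rewrite /x ler_pdivlMr//.
  have -> : (eps ^+ 2)^-1 * (45 * L * F) * n%:R = 45 * L * F * (n%:R * eps ^- 2) * 1 by ring.
  have ne0 : 0 <= n%:R * eps ^- 2 by rewrite mulr_ge0 ?invr_ge0 ?exprn_ge0 ?(ltW e0).
  apply: ler_pM => //; first exact: mulr_ge0.
  apply: ler_pM => //.
  by apply: le_trans w2; rewrite /w; lra.
have l0 : 0 < l by exact: log_factor_gt0.
have ll : l <= 12 * w * q.
  rewrite /l /log_factor -[8 * n%:R * T%:R]mulrA -natrM.
  by apply: (log_budget w1 u1 m0 mu2 (erefl q) _ Nle r0 ru); rewrite ltr0n muln_gt0 n0.
rewrite -/K; apply: powR13_le; rewrite ?(ltW l0) ?(ltW e0)//.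
have e30 : 0 < eps ^+ 3 by rewrite exprn_gt0.
(* Multiplying by the square root of [n] turns the requirement into sqrt(K^3) l s <= n T. It holds
   since s <= m and sqrt(K^3) l <= 12 sqrt(K^3) w q <= w^2 q. *)
rewrite -ler_pdivrMl// -(ler_pM2l (lt_le_trans ltr01 sn1)).
rewrite [leRHS]mulrA -[_ * Num.sqrt _]expr2 sqr_sqrtr ?(ltW nr0)// -natrM.
apply: le_trans Nge.
have -> : Num.sqrt n%:R * ((eps ^+ 3)^-1 * (Num.sqrt (K ^+ 3) * l)) =
    Num.sqrt (K ^+ 3) * l * s by rewrite /s; ring.
apply: (@le_trans _ _ (w ^+ 2 * q * m)); last by rewrite mulrAC.
rewrite ler_pM ?(ltW s0) ?mulr_ge0 ?(ltW l0)//.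
apply: le_trans (ler_wpM2l sK0 ll) _.
have : 12 * Num.sqrt (K ^+ 3) <= w by rewrite /w; lra.
move/(ler_wpM2r (ltW w0))/(ler_wpM2r (ltW q0)); rewrite -expr2 => H.
by apply: le_trans H; rewrite le_eqVlt; apply/orP; left; apply/eqP; ring.
Qed.
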